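(* There exists a finite $3$-group that is an ECP-group and is not regular.
   Context: For a subgroup $H$ of a group $G$ and $x\in G$, $H^x=x^{-1}Hx$, and for subgroups $A,B\le G$, $AB=\{ab : a\in A,\ b\in B\}$. A subgroup $H$ of $G$ is called conjugate-permutable in $G$ if $HH^x=H^xH$ for every $x\in G$. A group is called an ECP-group if every one of its subgroups is conjugate-permutable. A finite $p$-group $G$ is called regular (in the sense of P. Hall) if for all $a,b\in G$ there are finitely many elements $c_1,\dots,c_r$ of the derived subgroup $\langle a,b\rangle'$ of $\langle a,b\rangle$ such that $(ab)^p=a^pb^pc_1^p\cdots c_r^p$. *)

(* Defs.v *)
From mathcomp Require Import all_boot all_fingroup all_solvable.

Set Implicit Arguments.
Unset Strict Implicit.
Unset Printing Implicit Defensive.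

Local Open Scope group_scope.

Definition conjugate_permutable (gT : finGroupType) (G H : {group gT}) : Prop :=
  forall x, x \in G -> H * H :^ x = H :^ x * H.

Definition ECP_group (gT : finGroupType) (G : {group gT}) : Prop :=
  forall H : {group gT}, H \subset G -> conjugate_permutable G H.

(* P. Hall's regularity; G is not required here to be a p-group, the
   assumption under which the notion is meaningful. *)
Definition hall_regular (p : nat) (gT : finGroupType) (G : {group gT}) : Prop :=
  forall a b, a \in G -> b \in G ->
  exists2 cs : seq gT,
    {subset cs <= (<<[set a; b]>>)^`(1)} &
    (a * b) ^+ p = a ^+ p * b ^+ p * \prod_(c <- cs) c ^+ p.

(* Main.v *)
Require Import Defs.
From HB Require Import structures.
From mathcomp Require Import all_boot all_fingroup all_solvable.
From mathcomp Require Import all_algebra ring.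

(** Let pi = 1 - omega in Z[omega], omega a primitive cube root of unity, and
A = Z[omega]/(pi^3), where pi^2 = -3 and 3 pi = 0.  The group has order 81; it
is generated by A and an element s that acts on A as the unit exp(-pi) of
order 3 and satisfies s^3 = 3 in A.  The norm of exp(-pi) vanishes on A, so
every element outside A has a cube generating Z = 3A.

If H lies in A, it commutes elementwise with its conjugates.  Otherwise Z lies
in H; as G/Z has class 2, G' normalises H, hence so does H^x, which is
contained in H G'.  Finally G' = pi A has exponent 3, so regularity would force
(s a)^3 = s^3 a^3 for a in A, whereas (s a)^3 = s^3 and 1 in A has order 9. *)

Local Open Scope group_scope.

Section Group81.

Import GRing.Theory.
Local Open Scope ring_scope.

(* [(k, u, v, w)] stands for [a s^k] with [a = [u] + v pi + 3 w], where [[u]] is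
   the Teichmueller representative of [u] modulo 9. *)
Definition g81 : Type := ('F_3 * 'F_3 * 'F_3 * 'F_3)%type.
HB.instance Definition _ := Finite.on g81.

Implicit Types x y : g81.

Definition ck x : 'F_3 := x.1.1.1.
Definition cu x : 'F_3 := x.1.1.2.
Definition cv x : 'F_3 := x.1.2.
Definition cw x : 'F_3 := x.2.

(* The Witt vector carry [(a^3 + b^3 - (a + b)^3) / 3]. *)
Definition carry (a b : 'F_3) := - (a ^+ 2 * b + a * b ^+ 2).

Definition g81_one : g81 := (0, 0, 0, 0).

Definition g81_inv x : g81 :=
  (- ck x, - cu x, - cv x - ck x * cu x,
   - cw x + ck x * cv x - ck x ^+ 2 * cu x).

(* Here [s^k] acts on [A] as [exp(- k pi) = 1 - k pi + 3 k^2]. *)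
Definition g81_mul x y : g81 :=
  (ck x + ck y, cu x + cu y, cv x + cv y - ck x * cu y,
   cw x + cw y + carry (cu x) (cu y) + carry (ck x) (ck y)
   + ck x * cv y + ck x ^+ 2 * cu y).

(** [ring] does not use 3 = 0 in ['F_3], so [c] supplies the quotient of [a - b] by 3, computed with
    integer coefficients. *)
Lemma F3_eq (c a b : 'F_3) : a - b = 3%:R * c -> a = b.
Proof.
have -> : 3%:R = 0 :> 'F_3 by exact/val_inj.
by rewrite mul0r => /subr0_eq.
Qed.

Lemma F3_cube (a : 'F_3) : a ^+ 3 = a.
Proof. by case: a => [[|[|[|m]]] lt_m]; apply/val_inj. Qed.

Lemma g81_mulA : associative g81_mul.
Proof.
move=> [[[k u] v] w] [[[k' u'] v'] w'] [[[k'' u''] v''] w''].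
rewrite /g81_mul /carry /ck /cu /cv /cw /=.
congr (_, _, _, _); [ring | ring | ring |].
by apply: (@F3_eq (- (k * k' * u''))); ring.
Qed.

Lemma g81_mul1 : left_id g81_one g81_mul.
Proof.
move=> [[[k u] v] w]; rewrite /g81_mul /g81_one /carry /ck /cu /cv /cw /=.
by congr (_, _, _, _); ring.
Qed.

Lemma g81_mulV : left_inverse g81_one g81_inv g81_mul.
Proof.
move=> [[[k u] v] w].
rewrite /g81_mul /g81_inv /g81_one /carry /ck /cu /cv /cw /=.
by congr (_, _, _, _); ring.
Qed.

HB.instance Definition _ :=
  Finite_isGroup.Build g81 g81_mulA g81_mul1 g81_mulV.

Local Open Scope group_scope.

Lemma g81E x y : x * y = g81_mul x y. Proof. by []. Qed.

Lemma ckM x y : ck (x * y) = (ck x + ck y)%R. Proof. by []. Qed.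

Lemma cuM x y : cu (x * y) = (cu x + cu y)%R. Proof. by []. Qed.

Lemma ckV x : ck x^-1 = (- ck x)%R. Proof. by []. Qed.

Lemma cuV x : cu x^-1 = (- cu x)%R. Proof. by []. Qed.

Lemma ckJ x y : ck (x ^ y) = ck x.
Proof. by rewrite conjgE !ckM ckV; ring. Qed.

Lemma cuJ x y : cu (x ^ y) = cu x.
Proof. by rewrite conjgE !cuM cuV; ring. Qed.

Lemma ckR x y : ck [~ x, y] = 0%R.
Proof. by rewrite commgEl ckM ckV ckJ addNr. Qed.

Lemma cuR x y : cu [~ x, y] = 0%R.
Proof. by rewrite commgEl cuM cuV cuJ addNr. Qed.

(** The element 3 w of A; these form Z. *)
Definition zc (w : 'F_3) : g81 := (0, 0, 0, w)%R.

Lemma zcX w n : zc w ^+ n = zc (w *+ n)%R.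
Proof.
elim: n => [|n IHn]; first by rewrite mulr0n.
rewrite expgS IHn g81E mulrS; move: (w *+ n)%R => w'.
rewrite /zc /g81_mul /carry /ck /cu /cv /cw /=.
by congr (_, _, _, _); ring.
Qed.

(** When [ck x] is nonzero its square is 1 and the terms in [cu x] cancel: this is the vanishing
    norm. When it is 0, multiplication by 3 in A remains. *)
Lemma g81_cube x :
  x ^+ 3 = zc (ck x ^+ 3 + cu x ^+ 3 - ck x ^+ 2 * cu x)%R.
Proof.
case: x => [[[k u] v] w].
rewrite expgS expg2 !g81E /zc /g81_mul /carry /ck /cu /cv /cw /=.
congr (_, _, _, _).
- by apply: (@F3_eq k); ring.
- by apply: (@F3_eq u); ring.
- by apply: (@F3_eq (v - k * u)%R); ring.
by apply: (@F3_eq (w - 3%:R * (k ^+ 3 + u ^+ 3) + k * v + k ^+ 2 * u)%R); ring.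
Qed.

Lemma ck0_commute x y : ck x = 0%R -> ck y = 0%R -> commute x y.
Proof.
case: x y => [[[k u] v] w] [[[k' u'] v'] w']; rewrite /ck /= => -> ->.
rewrite /commute !g81E /g81_mul /carry /ck /cu /cv /cw /=.
by congr (_, _, _, _); ring.
Qed.

(** Such a [c] lies in pi A, and powers of s move it only by elements of pi^2 A = Z. *)
Lemma conj_zc x c : ck c = 0%R -> cu c = 0%R -> x ^ c = x * zc (ck x * cv c)%R.
Proof.
case: x c => [[[k u] v] w] [[[k' u'] v'] w']; rewrite /ck /cu /= => -> ->.
apply: (@mulgI g81 (0, 0, v', w')%R); rewrite -conjgC !g81E.
rewrite /zc /g81_mul /carry /ck /cu /cv /cw /=.
by congr (_, _, _, _); ring.
Qed.

Lemma zc_cycle x w : ck x != 0%R -> zc w \in <[x]>.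
Proof.
move=> kx0; suff: zc (ck x) \in <[x]>.
  have {kx0}[n ->]: exists n, w = (ck x *+ n)%R.
    by exists (w / ck x)%R; rewrite -mulr_natr natr_Zp mulrC divfK.
  by rewrite -zcX; apply: groupX.
have := mem_cycle x 3; rewrite g81_cube !F3_cube.
suff -> : (ck x ^+ 2 = 1)%R by rewrite mul1r addrK.
by apply: (mulfI kx0); rewrite -exprS F3_cube mulr1.
Qed.

Lemma g81_ECP : ECP_group [set: g81].
Proof.
move=> H _ x _; have [/forall_inP k0 | ] := boolP [forall h in H, ck h == 0%R].
  apply/normC/cents_norm/centsP => g Hg _ /imsetP[h Hh ->].
  by apply: ck0_commute; rewrite ?ckJ; apply/eqP/k0.
rewrite negb_forall_in => /exists_inP[g Hg kg].
have zcH w : zc w \in H by rewrite (subsetP _ _ (zc_cycle _ w kg)) ?cycle_subG.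
symmetry; apply: normC; apply/subsetP => _ /imsetP[h Hh ->].
rewrite inE; apply/subsetP => _ /imsetP[y Hy ->].
(* Conjugation by [h] keeps [y] in [H]; the commutator then changes it only by a factor in Z, which
   [H] contains. *)
have -> : h ^ x = h * [~ h, x] by rewrite commgEl mulKVg.
by rewrite conjgM conj_zc ?ckR ?cuR // groupM ?zcH ?groupJ.
Qed.

(** This is pi A. *)
Definition K81 : {set g81} := [set x | (ck x == 0%R) && (cu x == 0%R)].

Lemma K81_group_set : group_set K81.
Proof.
apply/group_setP; split=> [|x y]; rewrite !inE ?eqxx //.
move=> /andP[/eqP kx /eqP ux] /andP[/eqP ky /eqP uy].
by rewrite ckM cuM kx ux ky uy addr0 eqxx.
Qed.
Canonical K81_group := Group K81_group_set.

Lemma der1_K81 (A : {set g81}) : A^`(1) \subset K81.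
Proof.
rewrite gen_subG; apply/subsetP => _ /imset2P[x y _ _ ->].
by rewrite inE ckR cuR eqxx.
Qed.

Lemma K81_cube x : x \in K81 -> x ^+ 3 = 1.
Proof.
rewrite inE g81_cube => /andP[/eqP-> /eqP->].
by rewrite mulr0 !expr0n /= addr0 subr0.
Qed.

Lemma g81_not_regular : ~ hall_regular 3 [set: g81].
Proof.
(* The witnesses are s and the unit 1 of A. *)
move=> /(_ (1, 0, 0, 0)%R (0, 1, 0, 0)%R (in_setT _) (in_setT _)) [cs].
move=> cs_der; rewrite big1_seq => [|c /andP[_ /cs_der c_der]]; last first.
  exact/K81_cube/(subsetP (der1_K81 _) _ c_der).
(* The last coordinate is 1 + 1 - 1 = 1 on the left and 1 + 1 = 2 on the right. *)
by rewrite mulg1 !g81_cube => /(congr1 cw) /(congr1 val).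
Qed.

Lemma g81_pgroup : 3.-group [set: g81].
Proof. by rewrite /pgroup cardsT !card_prod card_Fp. Qed.

End Group81.

Theorem theorem3 :
  exists (gT : finGroupType) (G : {group gT}),
    [/\ 3.-group G, ECP_group G & ~ hall_regular 3 G].
Proof.
exists g81, [set: g81]%G.
by split; [apply: g81_pgroup | apply: g81_ECP | apply: g81_not_regular].
Qed.
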